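(* Let $\Gamma$ be a non-Abelian group of order $n$, let $S\subseteq\Gamma$ with $|S|=s$, and let $m\ge1$ be an integer. Then $G_m(S)=(V_0\cup V_1,E)$ is a bipartite graph with $(m+1)n$ vertices, where every vertex in $V_0$ has degree $ms$ and every vertex in $V_1$ has degree $s$. Moreover, the diameter of $G_m(S)$ is $3$ if both $S$ and $\overline{S}=\{t^{-1}: t\in S\}$ are covering difference sets of $\Gamma$.
   Context: Let $\Gamma$ be a finite group (written multiplicatively) and $S\subseteq\Gamma$. $S$ is a covering difference set (covering set) of $\Gamma$ if the multiset of differences $\{t\cdot t'^{-1} : t,t'\in S\}$ contains all the elements of $\Gamma$ (perhaps with some repetitions). For an integer $m\ge1$, $G_m(S)=(V_0\cup V_1,E)$ is the bipartite graph with independent sets $V_0=\{(0,u):u\in\Gamma\}$ and $V_1=\{(l,v): v\in\Gamma,\ 1\le l\le m\}$, and adjacencies $(l,v)\sim(0,v\cdot\sigma)$ for all $\sigma\in S$, $v\in\Gamma$ and $l\in\{1,\dots,m\}$.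
   Formalization: The claim that the diameter is 3 is stated only for S different from the whole group Γ: for S = Γ both S and its inverse set are covering, but G_m(Γ) is complete bipartite and has diameter 2. *)

(* Defs.v *)
From mathcomp Require Import all_boot all_fingroup.
Set Implicit Arguments.
Unset Strict Implicit.
Unset Printing Implicit Defensive.

Local Open Scope nat_scope.

Section Graphs.

Variables (T : finType) (e : rel T).

Definition simple_graph : Prop := symmetric e /\ irreflexive e.

Definition independent_set (A : {set T}) : Prop := {in A &, forall x y, ~~ e x y}.

Definition bipartite_with (A B : {set T}) : Prop :=
  [/\ A :|: B = [set: T], [disjoint A & B],
      independent_set A & independent_set B].

Definition degree (x : T) : nat := #|[set y | e x y]|.

Definition walk (x y : T) (p : seq T) : Prop := path e x p /\ last x p = y.

(* The walk x :: p has size p edges; vertices in different connected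
   components are at no finite distance. *)
Definition is_distance (x y : T) (d : nat) : Prop :=
  (exists2 p, walk x y p & size p = d) /\
  (forall p, walk x y p -> d <= size p).

(* A disconnected graph satisfies this for no d (infinite diameter). *)
Definition is_diameter (d : nat) : Prop :=
  (forall x y, exists2 k, is_distance x y k & k <= d) /\
  (exists x y, is_distance x y d).

End Graphs.

Section CoveringSetGraph.

Variable gT : finGroupType.

Local Open Scope group_scope.

Definition covering_set (S : {set gT}) : Prop :=
  forall g : gT, exists t t' : gT, [/\ t \in S, t' \in S & g = t * t'^-1].

Variables (m : nat) (S : {set gT}).

(* The vertex (l, v) is a pair in 'I_m.+1 * gT: layer 0 is V0 and the layers
   1, ..., m make up V1. *)
Definition GV0 : {set 'I_m.+1 * gT} := [set x : 'I_m.+1 * gT | x.1 == ord0].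
Definition GV1 : {set 'I_m.+1 * gT} :=
  [set x : 'I_m.+1 * gT | (1 <= x.1 <= m)%N].

Definition Garc (x y : 'I_m.+1 * gT) : bool :=
  [&& x \in GV1, y \in GV0 & [exists sigma in S, y.2 == x.2 * sigma]].

Definition Gadj : rel ('I_m.+1 * gT) := [rel x y | Garc x y || Garc y x].

End CoveringSetGraph.

Arguments GV0 gT m : clear implicits.
Arguments GV1 gT m : clear implicits.
Arguments Garc {gT} m S x y.
Arguments Gadj {gT} m S.

(* Main.v *)
Require Import Defs.
From mathcomp Require Import all_boot all_fingroup.

(** The arc relation says that [v^-1 * u] lies in [S].  Two vertices of [V0] have
a common neighbour because [t^-1 * t'] takes every value, two vertices of [V1]
because [t * t'^-1] does, and vertices on opposite sides are joined by one step
followed by such a path of length 2.  Opposite sides are at odd distance, so a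
pair [(0, g)], [(l, 1)] with [g] outside [S] is at distance exactly 3. *)

(** The lengths of walks from [x] to [y] form a nonempty set of naturals; its least element is the
    distance, bounded by the length of the given walk. *)
Lemma ex_distance (T : finType) (e : rel T) (x y : T) (p : seq T) (d : nat) :
  walk e x y p -> size p <= d -> exists2 k, is_distance e x y k & k <= d.
Proof.
move=> xy_p le_pd.
(* The [k]-tuples form a finite type, so the existence of a walk with [k] edges becomes a boolean,
   as [ex_minnP] requires. *)
pose P k := [exists q : k.-tuple T, path e x q && (last x q == y)].
have walkP q : walk e x y q -> P (size q).
  by case=> eq lq; apply/existsP; exists (in_tuple q); rewrite eq lq eqxx.
have exP : exists k, P k by exists (size p); apply: walkP.
case: (ex_minnP exP) => k /existsP[q /andP[eq /eqP lq]] min_k.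
exists k; last exact: leq_trans (min_k _ (walkP _ xy_p)) le_pd.
split; first by exists q => //; exact: size_tuple.
by move=> r /walkP/min_k.
Qed.

Section CoveringSetGraph.

Local Open Scope group_scope.

Variables (gT : finGroupType) (m : nat) (S : {set gT}).

Implicit Types (x y z : 'I_m.+1 * gT) (g u v : gT) (l : 'I_m.+1).

Lemma in_GV0 x : (x \in GV0 gT m) = (x.1 == ord0).
Proof. by rewrite inE. Qed.

Lemma in_GV1 x : (x \in GV1 gT m) = (x.1 != ord0).
Proof. by rewrite inE leq_ord andbT lt0n. Qed.

Lemma GV1E : GV1 gT m = ~: GV0 gT m.
Proof. by apply/setP=> x; rewrite in_setC in_GV0 in_GV1. Qed.

(** The two ends of an arc determine its generator: [sigma] can only be [x.2^-1 * y.2]. *)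
Lemma GarcE x y :
  Garc m S x y = [&& x.1 != ord0, y.1 == ord0 & x.2^-1 * y.2 \in S].
Proof.
rewrite /Garc in_GV0 in_GV1; congr [&& _, _ & _].
apply/exists_inP/idP => [[t tS /eqP->]|xyS]; first by rewrite mulKg.
by exists (x.2^-1 * y.2); rewrite // mulKVg.
Qed.

Lemma Gadj_sym : symmetric (Gadj m S).
Proof. by move=> x y; rewrite /Gadj /= orbC. Qed.

(** An arc crosses sides in either orientation. Looplessness, independence of both sides and the
    parity of walks all rest on this. *)
Lemma Gadj_side x y : Gadj m S x y -> (y.1 == ord0) = (x.1 != ord0).
Proof. by rewrite /Gadj /= !GarcE => /orP[]/and3P[/negbTE-> ->]. Qed.

Lemma Gadj0 x y : x.1 == ord0 ->
  Gadj m S x y = (y.1 != ord0) && (y.2^-1 * x.2 \in S).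
Proof. by rewrite /Gadj /= !GarcE => ->. Qed.

Lemma Gadj1 x y : x.1 != ord0 ->
  Gadj m S x y = (y.1 == ord0) && (x.2^-1 * y.2 \in S).
Proof. by rewrite /Gadj /= !GarcE => x1; rewrite x1 (negbTE x1) andbF orbF. Qed.

Lemma Gadj_simple : simple_graph (Gadj m S).
Proof.
split; first exact: Gadj_sym.
by move=> x; apply/negP => /Gadj_side; case: eqP.
Qed.

Lemma Gadj_bipartite : bipartite_with (Gadj m S) (GV0 gT m) (GV1 gT m).
Proof.
rewrite GV1E; split; first exact: setUCr.
- by rewrite -setI_eq0 setICr.
- by move=> x y; rewrite !in_GV0 => x0 y0; apply/negP => /Gadj_side; rewrite x0 y0.
move=> x y; rewrite !in_setC !in_GV0 => x1 y1.
by apply/negP => /Gadj_side; rewrite x1 (negbTE y1).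
Qed.

Lemma degree_GV0 x : x \in GV0 gT m -> degree (Gadj m S) x = (m * #|S|)%N.
Proof.
rewrite in_GV0 => x0.
(* The map is injective, so each layer other than 0 contributes [#|S|] neighbours. *)
rewrite -(card_preimset S (f := fun v => v^-1 * x.2)); last first.
  by move=> v w /mulIg/invg_inj.
transitivity #|setX [set~ (ord0 : 'I_m.+1)] ((fun v => v^-1 * x.2) @^-1: S)|.
  by apply: eq_card => y; rewrite inE (Gadj0 _ _ x0) !inE.
by rewrite cardsX cardsC1 card_ord.
Qed.

Lemma degree_GV1 x : x \in GV1 gT m -> degree (Gadj m S) x = #|S|.
Proof.
rewrite in_GV1 => x1.
rewrite -(card_preimset S (mulgI x.2^-1)).
transitivity #|setX [set (ord0 : 'I_m.+1)] ((fun u => x.2^-1 * u) @^-1: S)|.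
  by apply: eq_card => y; rewrite inE (Gadj1 _ _ x1) !inE.
by rewrite cardsX cards1 mul1n.
Qed.

Lemma GV0_common_neighbour l x y :
  covering_set [set t^-1 | t in S] -> l != ord0 -> x.1 == ord0 -> y.1 == ord0 ->
  exists2 z, Gadj m S x z & Gadj m S z y.
Proof.
move=> covS l1 x0 y0.
have [_ [_ [/imsetP[a aS ->] /imsetP[b bS ->]]]] := covS (x.2^-1 * y.2).
(* The middle vertex [v] has to satisfy [v * a = x.2] and [v * b = y.2]; the layer [l] is free. *)
rewrite invgK => xy; exists (l, x.2 * a^-1).
  by rewrite Gadj0 //= l1 invMg invgK mulgKV.
by rewrite Gadj1 //= y0 invMg invgK -mulgA xy mulKVg.
Qed.

Lemma GV1_common_neighbour x y :
  covering_set S -> x.1 != ord0 -> y.1 != ord0 ->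
  exists2 z, Gadj m S x z & Gadj m S z y.
Proof.
move=> covS x1 y1; have [a [b [aS bS xy]]] := covS (x.2^-1 * y.2).
(* From [x.2^-1 * y.2 = a * b^-1] follows [x.2 * a = y.2 * b], so both vertices reach this one. *)
exists (ord0, x.2 * a); first by rewrite Gadj1 //= mulKg.
have xa_yb : x.2 * a = y.2 * b by rewrite -(mulKVg x.2 y.2) xy -mulgA mulgKV.
by rewrite Gadj0 //= y1 xa_yb mulKg.
Qed.

Lemma Gadj_walk_le3 x y : 0 < m ->
  covering_set S -> covering_set [set t^-1 | t in S] ->
  exists2 p, walk (Gadj m S) x y p & size p <= 3.
Proof.
move=> m_gt0 covS covS'.
have max1 : ord_max != ord0 :> 'I_m.+1 by rewrite -lt0n.
(* Covering the identity makes [S] nonempty; [a] then gives every vertex of [GV1] a neighbour in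
   layer 0. *)
have [a [_ [aS _ _]]] := covS 1.
have [x0|x1] := boolP (x.1 == ord0); have [y0|y1] := boolP (y.1 == ord0).
- have [z xz zy] := GV0_common_neighbour ord_max x y covS' max1 x0 y0.
  by exists [:: z; y] => //; split=> //=; rewrite xz zy.
- pose w : 'I_m.+1 * gT := (ord0, y.2 * a).
  have wy : Gadj m S w y by rewrite Gadj0 //= y1 mulKg.
  have [z xz zw] := GV0_common_neighbour ord_max x w covS' max1 x0 (eqxx _).
  by exists [:: z; w; y] => //; split=> //; rewrite /path xz zw wy.
- pose w : 'I_m.+1 * gT := (ord0, x.2 * a).
  have xw : Gadj m S x w by rewrite Gadj1 //= mulKg.
  have [z wz zy] := GV0_common_neighbour ord_max w y covS' max1 (eqxx _) y0.
  by exists [:: w; z; y] => //; split=> //; rewrite /path xw wz zy.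
have [z xz zy] := GV1_common_neighbour x y covS x1 y1.
by exists [:: z; y] => //; split=> //; rewrite /path xz zy.
Qed.

(** Without edges the ends coincide, a single edge contradicts non-adjacency, and two edges return
    to the starting side. *)
Lemma walk_ge3 x y p : x.1 == ord0 -> y.1 != ord0 -> ~~ Gadj m S x y ->
  walk (Gadj m S) x y p -> 3 <= size p.
Proof.
move=> x0 y1 nxy [].
case: p => [|z [|w [|? ?]]] //=.
- by move=> _ xy; rewrite -xy x0 in y1.
- by rewrite andbT => xz zy; rewrite -zy [Gadj _ _ _ _]xz in nxy.
case/and3P=> /Gadj_side xz /Gadj_side zw _ wy.
by rewrite -wy zw xz x0 in y1.
Qed.

(** For [S] the whole group the graph is complete bipartite, of diameter at most 2; hence the
    condition [S <> [set: gT]]. *)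
Lemma Gadj_diameter3 : 0 < m -> S <> [set: gT] ->
  covering_set S -> covering_set [set t^-1 | t in S] ->
  is_diameter (Gadj m S) 3.
Proof.
move=> m_gt0 SnT covS covS'; split=> [x y|].
  have [p xy_p le_p3] := Gadj_walk_le3 x y m_gt0 covS covS'.
  exact: ex_distance xy_p le_p3.
have [g gS] : exists g, g \notin S.
  by apply/existsP; rewrite -negb_forall; apply/forallP => allS; apply: SnT;
     apply/setP => g; rewrite inE allS.
pose x : 'I_m.+1 * gT := (ord0, g); pose y : 'I_m.+1 * gT := (ord_max, 1).
have y1 : y.1 != ord0 by rewrite -lt0n.
have nxy : ~~ Gadj m S x y by rewrite Gadj0 // y1 invg1 mul1g.
have ge3 p : walk (Gadj m S) x y p -> 3 <= size p by exact: walk_ge3.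
exists x, y; split=> //.
have [p xy_p le_p3] := Gadj_walk_le3 x y m_gt0 covS covS'.
by exists p => //; apply/eqP; rewrite eqn_leq le_p3 ge3.
Qed.

End CoveringSetGraph.

Theorem corollary3p3 (gT : finGroupType) (n : nat) (S : {set gT}) (s m : nat)
    (hn : #|[set: gT]| = n) (hna : ~~ abelian [set: gT])
    (hs : #|S| = s) (hm : (1 <= m)%N) :
  [/\ simple_graph (Gadj m S) /\ bipartite_with (Gadj m S) (GV0 gT m) (GV1 gT m),
      #|GV0 gT m :|: GV1 gT m| = ((m + 1) * n)%N,
      forall x, x \in GV0 gT m -> degree (Gadj m S) x = (m * s)%N,
      forall x, x \in GV1 gT m -> degree (Gadj m S) x = s
    & S <> [set: gT] ->
      covering_set S -> covering_set [set (t^-1)%g | t in S] ->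
      is_diameter (Gadj m S) 3].
Proof.
rewrite -hs -hn; split.
- by split; [exact: Gadj_simple | exact: Gadj_bipartite].
- by rewrite GV1E setUCr !cardsT card_prod card_ord addn1.
- exact: degree_GV0.
- exact: degree_GV1.
exact: Gadj_diameter3.
Qed.
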